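(* Let $f:\mathbb{N}^k\to\mathbb{C}$ with $f(\mathbf{1})\ne0$ and $f(\mathbf{n})=0$ for every $\mathbf{n}$ not satisfying $n_1\le n_2\le\cdots\le n_k$. Suppose there exist $C>0$ and $r_1,\ldots,r_k\in\mathbb{R}$ with $|f(\mathbf{n})|\le Cn_1^{r_1}\cdots n_k^{r_k}$ for all $\mathbf{n}\ne\mathbf{1}$, and let $\alpha_j>1+r_j$ $(j=1,\ldots,k)$ satisfy $\zeta(\alpha_1-r_1)\cdots\zeta(\alpha_k-r_k)\le1+|f(\mathbf{1})|/C$. Then $F(s_1,\ldots,s_k;f)$ and $F(s_1,\ldots,s_k;f^{-1})$ have no zeros in the region $$\{(s_1,\ldots,s_k)\in\mathbb{C}^k : \Re(s_k(k-l+1))>l+\alpha_k(k-l+1)\ (l=1,\ldots,k)\},$$ where $s_k(m)=s_m+s_{m+1}+\cdots+s_k$ and $\alpha_k(m)=\alpha_m+\alpha_{m+1}+\cdots+\alpha_k$. Moreover, in this region $(F(s_1,\ldots,s_k;f))^{-1}=F(s_1,\ldots,s_k;f^{-1})$.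
   Context: $\mathbf{1}=(1,\ldots,1)$; $\zeta$ is the Riemann zeta function. For $g:\mathbb{N}^k\to\mathbb{C}$, $F(s_1,\ldots,s_k;g):=\sum_{m_1,\ldots,m_k=1}^\infty \frac{g(m_1,\ldots,m_k)}{m_1^{s_1}\cdots m_k^{s_k}}$. The multiple Dirichlet product is $(f*g)(\mathbf{n})=\sum_{\mathbf{a}\cdot\mathbf{b}=\mathbf{n}} f(\mathbf{a})g(\mathbf{b})$ with $\mathbf{a}\cdot\mathbf{b}=(a_1b_1,\ldots,a_kb_k)$; its identity $I$ has $I(\mathbf{1})=1$, $I(\mathbf{n})=0$ otherwise; $f^{-1}$ is the function with $f*f^{-1}=I$. *)

(* Defs.v *)
From mathcomp Require Import all_boot all_order all_algebra complex.
From mathcomp Require Import all_classical all_reals all_analysis.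
From mathcomp.analysis.showcase Require summability.

Set Implicit Arguments.
Unset Strict Implicit.
Unset Printing Implicit Defensive.

Import Order.TTheory GRing.Theory Num.Theory numFieldNormedType.Exports.

Local Open Scope classical_set_scope.
Local Open Scope ring_scope.
Local Open Scope complex_scope.

Definition posnat := {n : nat | (0 < n)%N}.

Definition pos1 : posnat := exist _ 1%N isT.

Definition mulp (a b : posnat) : posnat :=
  exist _ (val a * val b)%N
    (etrans (muln_gt0 (val a) (val b)) (introT andP (conj (valP a) (valP b)))).

Definition multi_index (k : nat) := {ffun 'I_k -> posnat}.

Section MultiIndex.
Variable k : nat.
Implicit Types a b n : multi_index k.

Definition mi1 : multi_index k := [ffun _ => pos1].

Definition mi_mul a b : multi_index k := [ffun j => mulp (a j) (b j)].

Definition mi_nondecreasing n : Prop :=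
  forall i j : 'I_k, (i <= j)%N -> (val (n i) <= val (n j))%N.

Definition factorizations n : set (multi_index k * multi_index k) :=
  [set ab | mi_mul ab.1 ab.2 = n].

Definition mi_size n : nat := \prod_(j < k) val (n j).

Lemma mi_size_gt0 n : (0 < mi_size n)%N.
Proof. by apply: prodn_gt0 => j; exact: valP. Qed.

Lemma mi_size_mul a b : mi_size (mi_mul a b) = (mi_size a * mi_size b)%N.
Proof. by rewrite /mi_size -big_split; apply: eq_bigr => j _; rewrite ffunE. Qed.

Lemma mi_size_eq1 n : mi_size n = 1%N -> n = mi1.
Proof.
move=> n1; apply/ffunP => j; rewrite ffunE; apply: val_inj => /=; apply/eqP.
have : (val (n j) %| mi_size n)%N by rewrite /mi_size (bigD1 j)//= dvdn_mulr.
by rewrite n1 dvdn1.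
Qed.

Lemma mi_mul1l n : mi_mul mi1 n = n.
Proof. by apply/ffunP => j; apply: val_inj; rewrite !ffunE /= mul1n. Qed.

Lemma finite_factorizations n : finite_set (factorizations n).
Proof.
pose F := {ffun 'I_k -> 'I_(mi_size n).+1}.
pose toP (m : nat) : posnat := insubd pos1 m.
pose h (xy : F * F) : multi_index k * multi_index k :=
  ([ffun j => toP (xy.1 j)], [ffun j => toP (xy.2 j)]).
apply: (@sub_finite_set _ _ (h @` setT)); last first.
  exact: (finite_image h finite_finset).
move=> [a b] /= abn.
have key (c : multi_index k) : (mi_size c %| mi_size n)%N ->
    [ffun j => toP (([ffun i => inord (val (c i))] : F) j)] = c :> multi_index k.
  move=> cn; apply/ffunP => j; rewrite !ffunE.
  rewrite inordK; first exact: valKd.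
  rewrite ltnS; apply: leq_trans (dvdn_leq (mi_size_gt0 n) cn).
  apply: dvdn_leq (mi_size_gt0 c) _.
  by rewrite /mi_size (bigD1 j)//= dvdn_mulr.
exists ([ffun i => inord (val (a i))], [ffun i => inord (val (b i))]) => //.
have nab : mi_size n = (mi_size a * mi_size b)%N by rewrite -abn mi_size_mul.
rewrite /h /=; congr pair; apply: key; rewrite nab.
  exact: dvdn_mulr.
exact: dvdn_mull.
Qed.

End MultiIndex.
Arguments mi1 {k}.

Section DirichletSeries.
Variables (R : realType) (k : nat).
Implicit Types f g : multi_index k -> R[i].

(* The index set is finite by finite_factorizations. *)
Definition dirichlet_mul f g : multi_index k -> R[i] := fun n =>
  \sum_(ab \in factorizations n) (f ab.1 * g ab.2).

Definition dirichlet_id : multi_index k -> R[i] := fun n => (n == mi1)%:R.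

(* Well defined when f mi1 != 0, see dirichlet_invP and dirichlet_inv_unique;
   0 if f has no inverse. *)
Definition dirichlet_inv f : multi_index k -> R[i] :=
  xget (fun=> 0) [set g | dirichlet_mul f g = dirichlet_id].

Lemma dirichlet_mulD1 f g n : dirichlet_mul f g n =
  f mi1 * g n +
  \sum_(ab \in factorizations n `\ (mi1, n)) (f ab.1 * g ab.2).
Proof.
rewrite /dirichlet_mul (fsbigD1 (mi1, n))//=.
  exact: finite_factorizations.
exact: mi_mul1l.
Qed.

Lemma factorizations_lt n (ab : multi_index k * multi_index k) :
    (factorizations n `\ (mi1, n)) ab ->
  (mi_size ab.2 < mi_size n)%N.
Proof.
case: ab => a b [/= abn ne]; rewrite -abn mi_size_mul.
rewrite ltn_Pmull ?mi_size_gt0// ltn_neqAle mi_size_gt0 andbT.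
apply/eqP => /esym/mi_size_eq1 a1; apply: ne.
by rewrite /= in a1; rewrite -abn a1 mi_mul1l.
Qed.

Lemma dirichlet_inv_exists f : f mi1 != 0 ->
  exists g, dirichlet_mul f g = dirichlet_id.
Proof.
move=> f1.
pose step g n := (f mi1)^-1 * (dirichlet_id n -
  \sum_(ab \in factorizations n `\ (mi1, n)) (f ab.1 * g ab.2)).
pose G m := iter m step (fun=> 0).
have GE m p n : (mi_size n <= m)%N -> (mi_size n <= p)%N -> G m n = G p n.
  elim: m p n => [|m IH] [|p] n; rewrite ?leqn0 ?(gtn_eqF (mi_size_gt0 n))// => nm np.
  rewrite /G /= /step; congr (_ * (_ - _)); apply: eq_fsbigr => ab.
  rewrite inE => /factorizations_lt abn; congr (_ * _).
  by apply: IH; rewrite -ltnS (leq_trans abn).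
exists (fun n => G (mi_size n) n); apply/funext => n.
rewrite dirichlet_mulD1 (GE _ (mi_size n).+1)//= {1}/step mulVKf// .
rewrite [X in _ - X + _](_ : _ = \sum_(ab \in factorizations n `\ (mi1, n))
  (f ab.1 * G (mi_size ab.2) ab.2)) ?subrK//.
apply: eq_fsbigr => ab; rewrite inE => /factorizations_lt abn.
by congr (_ * _); apply: GE => //; exact: ltnW.
Qed.

Lemma dirichlet_inv_unique f g g' : f mi1 != 0 ->
  dirichlet_mul f g = dirichlet_id -> dirichlet_mul f g' = dirichlet_id ->
  g = g'.
Proof.
move=> f1 fg fg'; apply/funext => n.
have [m] := ubnP (mi_size n); elim: m n => // m IH n nm.
have := congr1 (@^~ n) (etrans fg (esym fg')); rewrite /= !dirichlet_mulD1.
rewrite [X in _ + X = _](_ : _ = \sum_(ab \in factorizations n `\ (mi1, n))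
  (f ab.1 * g' ab.2)); first by move=> /addIr/(mulfI f1).
apply: eq_fsbigr => ab; rewrite inE => /factorizations_lt abn.
by rewrite IH// (leq_trans abn).
Qed.

Lemma dirichlet_invP f : f mi1 != 0 ->
  dirichlet_mul f (dirichlet_inv f) = dirichlet_id.
Proof.
move=> /dirichlet_inv_exists[g fg]; rewrite /dirichlet_inv.
by case: xgetP => [h _ //|/(_ g)]; move/(_ fg).
Qed.

(* n ^ s = exp (s * ln n) for a positive integer n and a complex s *)
Definition cpow (n : posnat) (s : R[i]) : R[i] :=
  let x : R := (val n)%:R in
  (x `^ complex.Re s)%:C * (cos (complex.Im s * ln x) +i* sin (complex.Im s * ln x)).

Definition dirichlet_term g (s : 'I_k -> R[i]) : multi_index k -> R[i]^o :=
  fun m => g m / \prod_(j < k) cpow (m j) (s j).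

(* Multiple series are unordered sums: the limit of the finite partial sums
   along the directed set of finite sets of indices.  Over the complex numbers
   this is the same as absolute convergence. *)
Definition dirichlet_cvg g (s : 'I_k -> R[i]) : Prop :=
  cvg (summability.partial_sum (dirichlet_term g s) @ summability.totally).

Definition dirichlet_F g (s : 'I_k -> R[i]) : R[i] :=
  summability.sum (dirichlet_term g s).

End DirichletSeries.

(* The Riemann zeta function at a real argument x > 1. *)
Definition zeta (R : realType) (x : R) : R := limn (series (riemannR x)).

(* x_k(m) = x_m + ... + x_k, where x_j (1 <= j <= k) is x (j - 1) *)
Definition tail_sum (V : nmodType) (k : nat) (x : 'I_k -> V) (m : nat) : V :=
  \sum_(j < k | (m <= j.+1)%N) x j.

Definition region (R : realType) (k : nat) (alpha : 'I_k -> R) :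
    set ('I_k -> R[i]) :=
  [set s | forall l : nat, (1 <= l <= k)%N ->
    l%:R + tail_sum alpha (k - l + 1) < complex.Re (tail_sum s (k - l + 1))].

(* Main.v *)
(* Write g = f^-1.  Like f, g is supported on nondecreasing tuples, because these
   form a semigroup.  Induction on n gives |g(n)| <= n^alpha / |f(1)|: in
   f(1) g(n) = - sum_(ab = n, a != 1) f(a) g(b) the right side is at most
   C n^alpha / |f(1)| times the sum of a^(r - alpha) over divisors a != 1 of n, and
   that sum is at most prod_j zeta(alpha_j - r_j) - 1 <= |f(1)| / C.
   For s in the region, the tail sums of beta_j = Re s_j - alpha_j from m to k exceed
   (k - m + 1)(1 + e) for some e > 0, so Abel summation of sum_j beta_j ln n_j gives
   n^(-beta) <= prod_j n_j^-(1 + e) for nondecreasing n.  Hence both series converge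
   absolutely, and F(f) F(g) = F(f * g) = F(I) = 1. *)
Require Import Defs.
From mathcomp Require Import all_boot all_order all_algebra complex finmap ring.
From mathcomp Require Import all_classical all_reals all_analysis.
From mathcomp.analysis.showcase Require summability.

Set Implicit Arguments.
Unset Strict Implicit.
Unset Printing Implicit Defensive.

Import Order.TTheory GRing.Theory Num.Theory numFieldNormedType.Exports.
Import Normc.

Local Open Scope classical_set_scope.
Local Open Scope ring_scope.
Local Open Scope complex_scope.

(** * Unordered sums: convergence from bounded finite sums *)

Section UnorderedSums.
Import summability.

#[local] Existing Instance totally_filter.

Lemma partial_sumE (I : choiceType) (V : zmodType) (x : I -> V) (A : {fset I}) :
  partial_sum x A = \sum_(i <- A) x i.
Proof. by rewrite /partial_sum big_seq_fsetE. Qed.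

Lemma ler_sum_subseq (R : numDomainType) (I : choiceType) (F : I -> R)
    (s t : seq I) :
  uniq s -> uniq t -> {subset s <= t} -> (forall i, 0 <= F i) ->
  \sum_(i <- s) F i <= \sum_(i <- t) F i.
Proof.
move=> us ut st F0; have pst : perm_eq s [seq i <- t | i \in s].
  apply: uniq_perm => // [|i]; first exact: filter_uniq.
  by rewrite mem_filter; case: (boolP (i \in s)) => // /st ->.
rewrite (perm_big _ pst) big_filter [leRHS](bigID (mem s))/= lerDl.
by rewrite sumr_ge0.
Qed.

(** The limit is the supremum of the finite sums: a finite set whose sum comes within e of it stays
    that close when enlarged, as no term is negative. *)
Lemma cvg_ge0_partial_sum (R : realType) (I : choiceType) (x : I -> R) (M : R) :
    (forall i, 0 <= x i) -> (forall A : {fset I}, \sum_(i <- A) x i <= M) ->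
  exists l : R, partial_sum x @ totally --> l.
Proof.
move=> x0 xM; pose S := range (partial_sum x); exists (sup S).
have supS : has_sup S.
  split; first by exists (partial_sum x fset0), fset0.
  by exists M => _ [A _ <-]; rewrite partial_sumE.
apply/cvgrPdist_lt => e e0.
have [_ [A _ <-] Ae] := sup_adherent e0 supS.
exists A => // B /= AB; rewrite ger0_norm ?subr_ge0; last first.
  by apply: ub_le_sup; [exact: supS.2 | exists B].
rewrite ltrBlDl -ltrBlDr; apply: lt_le_trans Ae _.
by rewrite !partial_sumE ler_sum_subseq// => i /(fsubsetP AB).
Qed.

Lemma cvg_real_complex (R : realType) (T : Type) (F : set_system T)
    (FF : Filter F) (h : T -> R) (l : R) :
  h @ F --> l -> ((h x)%:C : R[i]^o) @[x --> F] --> (l%:C : R[i]^o).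
Proof.
move=> /cvgrPdist_lt hl; apply/cvgrPdist_lt => e.
(* A positive element of [R[i]] has zero imaginary part, so the tolerance is real. *)
case: e => e e' /=; rewrite ltcE/= => /andP[/eqP-> e0].
near=> x; rewrite -rmorphB normc_def/= expr0n/= addr0 sqrtr_sqr ltcR.
by near: x; exact: hl.
Unshelve. all: by end_near. Qed.

(** Real and imaginary parts are summed separately. A real family h dominated by [normc (x i)] is
    the difference of the nonnegative families [normc (x i)] and [normc (x i) - h i], whose finite
    sums are at most M and 2M. *)
Lemma abs_cvg_partial_sum (R : realType) (I : choiceType) (x : I -> R[i]^o)
    (M : R) : (forall A : {fset I}, \sum_(i <- A) normc (x i) <= M) ->
  exists l : R[i]^o, partial_sum x @ totally --> l.
Proof.
move=> xM.
have realcvg (h : I -> R) : (forall i, `|h i| <= normc (x i)) ->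
    exists l : R, partial_sum h @ totally --> l.
  move=> hx.
  have [||l1 hl1] := @cvg_ge0_partial_sum R I (fun i => normc (x i)) M.
  - by move=> i; apply: le_trans (hx i).
  - exact: xM.
  have [||l2 hl2] := @cvg_ge0_partial_sum R I
      (fun i => normc (x i) - h i) (M *+ 2).
  - by move=> i; rewrite subr_ge0; apply: le_trans (hx i); exact: ler_norm.
  - move=> A; rewrite mulr2n.
    apply: (@le_trans _ _ (\sum_(i <- A) (normc (x i) + normc (x i)))).
      apply: ler_sum => i _; rewrite lerD2l; apply: le_trans (hx i).
      by rewrite -normrN ler_norm.
    by rewrite big_split/= lerD.
  exists (l1 - l2).
  rewrite (_ : partial_sum h = partial_sum (fun i => normc (x i)) \-
      partial_sum (fun i => normc (x i) - h i)); first exact: cvgB.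
  apply/funext => A /=; rewrite !partial_sumE -sumrB.
  by apply: eq_bigr => i _; rewrite opprB addrC subrK.
have Re_le i : `|complex.Re (x i)| <= normc (x i).
  by rewrite -lecR; exact: normc_ge_Re.
have Im_le i : `|complex.Im (x i)| <= normc (x i).
  case: (x i) => a b /=; rewrite -sqrtr_sqr ler_wsqrtr// lerDr.
  exact: sqr_ge0.
have [a ha] := realcvg _ Re_le; have [b hb] := realcvg _ Im_le.
exists (a%:C + 'i * b%:C).
rewrite (_ : partial_sum x = fun A =>
  ((partial_sum (fun i => complex.Re (x i)) A)%:C : R[i]^o) +
  ('i : R[i]^o) * ((partial_sum (fun i => complex.Im (x i)) A)%:C : R[i]^o)).
  apply: cvgD; first exact: cvg_real_complex.
  by apply: cvgMr; exact: cvg_real_complex.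
apply/funext => A; rewrite !partial_sumE !rmorph_sum mulr_sumr -big_split/=.
by apply: eq_bigr => i _; exact: complexE.
Qed.

Lemma cvg_sum (R : realType) (I : choiceType) (x : I -> R[i]^o) (l : R[i]^o) :
  partial_sum x @ totally --> l -> sum x = l.
Proof. by move=> /cvg_lim; apply; exact: norm_hausdorff. Qed.

End UnorderedSums.

(** * Bounds for partial sums of the zeta series *)

Section Zeta.
Variables (R : realType) (a : R).
Hypothesis a1 : 1 < a.

Let a_ge0 : 0 <= a. Proof. by rewrite (le_trans ler01) ?ltW. Qed.

Let powR_antitone (m n : nat) : (0 < m <= n)%N ->
  (n%:R `^ a)^-1 <= (m%:R `^ a)^-1 :> R.
Proof.
move=> /andP[m0 mn]; have n0 := leq_trans m0 mn.
rewrite lef_pV2 ?posrE ?powR_gt0 ?ltr0n//.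
by rewrite ge0_ler_powR ?nnegrE ?ler0n ?ler_nat.
Qed.

(* The terms of index 2i and 2i+1 are both at most (2i)^-a, so that
   S(2N+1) <= 1 + 2^(1-a) S(N). *)
Let series_riemannR_double N :
  series (riemannR a) N.*2.+1 <= 1 + 2 `^ (1 - a) * series (riemannR a) N.
Proof.
elim: N => [|N IH].
  by rewrite /series/= big_nat1 big_geq// mulr0 addr0 /riemannR powR1 invr1.
rewrite doubleS [leLHS]seriesSr [X in X + _]seriesSr [X in _ * X]seriesSr.
rewrite mulrDr addrA -[leLHS]addrA; apply: lerD IH _.
rewrite /riemannR.
have -> : 2 `^ (1 - a) * (N.+1%:R `^ a)^-1 =
    (N.+1.*2%:R `^ a)^-1 + (N.+1.*2%:R `^ a)^-1 :> R.
  rewrite -mul2n natrM powRM// powRB ?pnatr_eq0 ?implybT// powRr1//.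
  by rewrite -mulr2n -[RHS]mulr_natl invfM mulrA.
by apply: lerD => //; rewrite ?doubleS ?powR_antitone//= doubleS.
Qed.

Let series_riemannR_nd : {homo series (riemannR a) : m n / (m <= n)%N >-> m <= n}.
Proof.
by apply/nondecreasing_seqP => n; rewrite seriesSr lerDl ltW// riemannR_gt0.
Qed.

(** With q = 2^(1-a) < 1, monotonicity gives S(N) <= S(2N+1) <= 1 + q S(N), which is solved for
    S(N). *)
Lemma series_riemannR_le N : series (riemannR a) N <= (1 - 2 `^ (1 - a))^-1.
Proof.
have q1 : 0 < 1 - 2 `^ (1 - a) :> R.
  rewrite subr_gt0 -[ltRHS](powRr0 2) /powR pnatr_eq0/= ltr_expR mul0r.
  by rewrite nmulr_rlt0 ?subr_lt0// ln_gt0// ltr1n.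
rewrite -[leRHS]mul1r ler_pdivlMr// mulrBr mulr1 lerBlDr mulrC.
apply: le_trans (series_riemannR_double N); apply: series_riemannR_nd.
by rewrite -addnn leqW// leq_addr.
Qed.

(** [zeta] is a [limn], so it bounds the partial sums only once they are known to converge; the
    uniform bound above supplies this. *)
Lemma series_riemannR_le_zeta N : series (riemannR a) N <= zeta a.
Proof.
apply: nondecreasing_cvgn_le => //; apply: nondecreasing_is_cvgn => //.
by exists ((1 - 2 `^ (1 - a))^-1) => _ [n _ <-]; exact: series_riemannR_le.
Qed.

End Zeta.

(** * Abel summation *)

Section Abel.
Variable R : realDomainType.

(** Subtracting the first value [x ord0] from every x splits off [x ord0] times the full sum of d;
    the remaining increments are again nondecreasing and nonnegative, with one coordinate fewer. *)
Lemma abel_sum_ge0 (k : nat) (x d : 'I_k -> R) :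
    (forall i j : 'I_k, (i <= j)%N -> x i <= x j) -> (forall i, 0 <= x i) ->
    (forall m, 0 <= tail_sum d m) ->
  0 <= \sum_(j < k) d j * x j.
Proof.
elim: k x d => [|k IH] x d xnd x0 d0; first by rewrite big_ord0.
have -> : \sum_(j < k.+1) d j * x j = tail_sum d 0 * x ord0 +
    \sum_(j < k) d (lift ord0 j) * (x (lift ord0 j) - x ord0).
  rewrite /tail_sum mulr_suml !big_ord_recl/= -addrA; congr (_ + _).
  by rewrite -big_split; apply: eq_bigr => j _ /=; rewrite -mulrDr addrC subrK.
apply: addr_ge0; first exact: mulr_ge0.
apply: (IH (fun j => x (lift ord0 j) - x ord0) (fun j => d (lift ord0 j))).
- by move=> i j ij; rewrite lerD2r xnd// !lift0.
- by move=> i; rewrite subr_ge0 xnd.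
(* Dropping the first coordinate shifts tails by one; [maxn m 1] keeps that coordinate out also when
   m = 0. *)
- move=> m; have := d0 (maxn m 1).+1.
  rewrite /tail_sum big_mkcond big_ord_recl/= ltnS geq_max ltnn andbF add0r.
  rewrite -big_mkcond/=; congr (0 <= _); apply: eq_bigl => j.
  by rewrite /bump/= add1n ltnS geq_max andbT.
Qed.

End Abel.

(** * The boxes {1, ..., N}^k as finite index sets *)

Section Boxes.
Variable k : nat.

Definition mi_of_box N (x : {ffun 'I_k -> 'I_N}) : multi_index k :=
  [ffun j => exist _ (x j).+1 isT].

Definition box N : {fset multi_index k} :=
  [fset mi_of_box x | x : {ffun 'I_k -> 'I_N}]%fset.

Lemma mi_of_box_inj N : injective (@mi_of_box N).
Proof.
move=> x y /ffunP xy; apply/ffunP => j; apply: val_inj.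
by have := xy j; rewrite !ffunE => /(congr1 val) [].
Qed.

Lemma in_box N (n : multi_index k) : (n \in box N) = [forall j, val (n j) <= N]%N.
Proof.
apply/imfsetP/forallP => [[x _ -> j]|nN]; first by rewrite ffunE/=.
have nN' j : ((val (n j)).-1 < N)%N by rewrite prednK//; exact: valP.
exists [ffun j => Ordinal (nN' j)] => //; apply/ffunP => j; rewrite !ffunE.
by apply: val_inj => /=; rewrite prednK//; exact: valP.
Qed.

Lemma box1 N : (0 < N)%N -> mi1 \in box N.
Proof. by move=> N0; rewrite in_box; apply/forallP => j; rewrite ffunE. Qed.

Lemma sub_box M N : (M <= N)%N -> (box M `<=` box N)%fset.
Proof.
move=> MN; apply/fsubsetP => n; rewrite !in_box => /forallP nM.
by apply/forallP => j; exact: leq_trans (nM j) MN.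
Qed.

Lemma fset_sub_box (A : {fset multi_index k}) : exists N, (A `<=` box N)%fset.
Proof.
exists (\max_(n <- A) \max_(j < k) val (n j))%N; apply/fsubsetP => n nA.
rewrite in_box; apply/forallP => j.
by apply: leq_trans (leq_bigmax_seq _ nA isT); exact: leq_bigmax.
Qed.

Lemma box_mul M N a b : a \in box M -> b \in box N -> mi_mul a b \in box (M * N).
Proof.
rewrite !in_box => /forallP aM /forallP bN; apply/forallP => j.
by rewrite ffunE /=; exact: leq_mul (aM j) (bN j).
Qed.

Lemma box_factors N a b : mi_mul a b \in box N -> (a \in box N) && (b \in box N).
Proof.
rewrite !in_box => /forallP abN; apply/andP; split; apply/forallP => j;
  apply: leq_trans (abN j); rewrite ffunE /= ?leq_pmulr ?leq_pmull//; exact: valP.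
Qed.

(** Distributivity expands the product of k sums over the functions from ['I_k] to ['I_N], which is
    how [box] is encoded. *)
Lemma sum_box (T : comNzSemiRingType) N (h : 'I_k -> nat -> T) :
  \sum_(n <- box N) \prod_(j < k) h j (val (n j)) =
  \prod_(j < k) \sum_(i < N) h j i.+1.
Proof.
rewrite big_imfset/=; last by move=> x y _ _; exact: mi_of_box_inj.
rewrite bigA_distr_bigA big_enum/=; apply: eq_bigr => x _.
by apply: eq_bigr => j _; rewrite ffunE.
Qed.

End Boxes.

(** * Modulus and multiplicativity of complex powers *)

Section ComplexPowers.
Variable R : realType.

Lemma normc_cpow (n : posnat) (s : R[i]) :
  normc (cpow n s) = (val n)%:R `^ complex.Re s.
Proof.
rewrite normcM /= cos2Dsin2 sqrtr1 mulr1 expr0n addr0 sqrtr_sqr.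
by rewrite ger0_norm ?powR_ge0.
Qed.

Lemma cpow_mul (a b : posnat) (s : R[i]) :
  cpow (mulp a b) s = cpow a s * cpow b s.
Proof.
have p0 (n : posnat) : (sval n)%:R \is @Num.pos R.
  by move: n => [n n0]; rewrite posrE ltr0n.
rewrite /cpow/= natrM powRM// lnM ?p0// mulrDr cosD sinD.
rewrite mulrACA -rmorphM; congr (_ * _); simpc.
by congr (_ +i* _); rewrite addrC.
Qed.

Lemma normc_sum (I : Type) (r : seq I) (P : pred I) (F : I -> R[i]) :
  normc (\sum_(i <- r | P i) F i) <= \sum_(i <- r | P i) normc (F i).
Proof.
rewrite -lecR rmorph_sum; exact: (@ler_norm_sum R[i] R[i]).
Qed.

Lemma normc_ge0 (z : R[i]) : 0 <= normc z.
Proof. by rewrite -ler0c; exact: (@normr_ge0 R[i] R[i]). Qed.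

End ComplexPowers.

(** * Support and growth of the Dirichlet inverse *)

Section DirichletInverse.
Variables (R : realType) (k : nat).
Implicit Types (f g : multi_index k -> R[i]) (n a b : multi_index k).

Lemma mi_nondecreasing1 : mi_nondecreasing (@mi1 k).
Proof. by move=> i j _; rewrite !ffunE. Qed.

Lemma mi_nondecreasing_mul a b :
  mi_nondecreasing a -> mi_nondecreasing b -> mi_nondecreasing (mi_mul a b).
Proof.
move=> ha hb i j ij; rewrite !ffunE.
exact: leq_mul (ha _ _ ij) (hb _ _ ij).
Qed.

Lemma mi_mulI a : injective (mi_mul a).
Proof.
move=> b b' /ffunP abb'; apply/ffunP => j; apply: val_inj.
have := abb' j; rewrite !ffunE => /(congr1 val)/eqP /=.
by rewrite eqn_pmul2l; [move/eqP | exact: valP].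
Qed.

(** Isolating the factorization (1, n) leaves second factors of smaller [mi_size], which allows
    induction on [mi_size n]. *)
Lemma dirichlet_inv_rec f n : f mi1 != 0 ->
  f mi1 * dirichlet_inv f n = dirichlet_id R n -
    \sum_(ab \in factorizations n `\ (mi1, n)) (f ab.1 * dirichlet_inv f ab.2).
Proof. by move=> f1; rewrite -(dirichlet_invP f1) dirichlet_mulD1 addrK. Qed.

(** If ab = n is not nondecreasing, then a or b is not: either f vanishes at a or, by induction, the
    inverse vanishes at b. *)
Lemma dirichlet_inv_supp f n : f mi1 != 0 ->
    (forall n, ~ mi_nondecreasing n -> f n = 0) ->
  ~ mi_nondecreasing n -> dirichlet_inv f n = 0.
Proof.
move=> f1 fnd; have [m] := ubnP (mi_size n); elim: m n => // m IH n nm nnd.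
apply: (mulfI f1); rewrite mulr0 dirichlet_inv_rec// fsbig1 ?subr0.
  rewrite /dirichlet_id; case: eqP => // n1; exfalso; apply: nnd.
  by rewrite n1; exact: mi_nondecreasing1.
move=> [a b] Sab; have bn := factorizations_lt Sab; case: Sab => /= abn _.
have [and|/fnd->] := pselect (mi_nondecreasing a); last by rewrite mul0r.
rewrite IH ?mulr0//; first exact: leq_trans bn nm.
by move=> bnd; apply: nnd; rewrite -abn; exact: mi_nondecreasing_mul.
Qed.

Definition mi_pow (n : multi_index k) (x : 'I_k -> R) : R :=
  \prod_(j < k) (val (n j))%:R `^ x j.

Lemma mi_pow_gt0 n x : 0 < mi_pow n x.
Proof. by apply: prodr_gt0 => j _; rewrite powR_gt0// ltr0n; exact: valP. Qed.

Lemma mi_powM a b x : mi_pow (mi_mul a b) x = mi_pow a x * mi_pow b x.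
Proof.
by rewrite -big_split; apply: eq_bigr => j _; rewrite ffunE/= natrM powRM.
Qed.

Lemma mi_powE n x : mi_pow n x = expR (\sum_(j < k) x j * ln (val (n j))%:R).
Proof.
rewrite expR_sum; apply: eq_bigr => j _.
by rewrite /powR pnatr_eq0 gtn_eqF//; exact: valP.
Qed.

Lemma mi_pow1 x : mi_pow mi1 x = 1.
Proof. by rewrite /mi_pow big1// => j _; rewrite ffunE powR1. Qed.

(* The leading 1 is the term of the divisor a = 1. *)
Lemma sum_factorizations_le n (x : 'I_k -> R) : (forall j, 1 < x j) ->
  1 + \sum_(ab \in factorizations n `\ (mi1, n)) mi_pow ab.1 (fun j => - x j) <=
  \prod_(j < k) zeta (x j).
Proof.
move=> x1; set S := _ `\ _; pose h a := mi_pow a (fun j => - x j).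
have finS : finite_set S.
  by apply: sub_finite_set (finite_factorizations n) => ab [].
rewrite fsbig_finite//=.
have S1 ab : ab \in fset_set S -> ab.1 != mi1 /\ mi_mul ab.1 ab.2 = n.
  rewrite in_fset_set// inE; case: ab => a b [/= abn ne]; split => //.
  by apply/eqP => a1; apply: ne; rewrite -abn a1 mi_mul1l.
pose t := mi1 :: [seq ab.1 | ab <- fset_set S].
have -> : 1 + \sum_(ab <- fset_set S) mi_pow ab.1 (fun j => - x j) =
    \sum_(a <- t) h a by rewrite big_cons big_map /h mi_pow1.
have n0 := mi_size_gt0 n.
(* No divisor is repeated: a determines b by cancellation, and a != 1 on [S]. *)
have tuniq : uniq t.
  rewrite /= map_inj_in_uniq ?fset_uniq ?andbT.
    by apply/mapP => -[ab /S1[+ _] a1]; rewrite -a1 eqxx.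
  move=> [a b] [a' b'] /S1[_ /= abn] /S1[_ /= abn'] /= aa'; rewrite -aa' in abn' *.
  by congr pair; apply: (@mi_mulI a); rewrite abn abn'.
have tbox : {subset t <= box k (mi_size n)}.
  move=> a; rewrite inE => /predU1P[->|]; first exact: box1.
  move=> /mapP[[a' b] /S1[_ /= abn] ->].
  suff /box_factors/andP[]// : mi_mul a' b \in box k (mi_size n) by [].
  rewrite abn in_box; apply/forallP => j; apply: dvdn_leq => //.
  by rewrite /mi_size (bigD1 j)//= dvdn_mulr.
(* Enlarging the set of divisors to a whole box makes the sum factor into k partial zeta sums. *)
apply: (@le_trans _ _ (\sum_(a <- box k (mi_size n)) h a)).
  apply: ler_sum_subseq => // a; exact/ltW/mi_pow_gt0.
rewrite /h /mi_pow (sum_box _ (fun j i => (i%:R : R) `^ (- x j))).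
apply: ler_prod => j _; apply/andP; split.
  by apply: sumr_ge0 => i _; exact: powR_ge0.
rewrite -(big_mkord xpredT (fun i => (i.+1%:R : R) `^ (- x j))).
under eq_bigr do rewrite powRN.
exact: series_riemannR_le_zeta.
Qed.

Lemma dirichlet_inv_le f (C : R) (r alpha : 'I_k -> R) n : f mi1 != 0 -> 0 < C ->
    (forall n, n <> mi1 -> normc (f n) <= C * mi_pow n r) ->
    (forall j, 1 + r j < alpha j) ->
    \prod_(j < k) zeta (alpha j - r j) <= 1 + normc (f mi1) / C ->
  normc (dirichlet_inv f n) <= (normc (f mi1))^-1 * mi_pow n alpha.
Proof.
move=> f1 C0 fC ra hzeta.
have c0 : 0 < normc (f mi1).
  rewrite lt_neqAle normc_ge0 andbT eq_sym; apply: contra f1 => /eqP.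
  by move=> /eq0_normc ->.
have [m] := ubnP (mi_size n); elim: m n => // m IH n nm.
rewrite -(ler_pM2l c0) mulVKf ?gt_eqF// -normcM dirichlet_inv_rec//.
rewrite /dirichlet_id; case: eqP => [n1|n1].
  (* At n = 1 the remaining sum is empty, as its second factors would have size below 1; the bound
     is an equality. *)
  rewrite fsbig1 ?subr0 ?normc1 ?n1 ?mi_pow1// => ab.
  move=> /factorizations_lt; rewrite [mi_size mi1]big1 ?ltnS ?leqn0.
    by rewrite gtn_eqF ?mi_size_gt0.
  by move=> j _; rewrite ffunE.
rewrite sub0r normcN.
have finS : finite_set (factorizations n `\ (mi1, n)).
  by apply: sub_finite_set (finite_factorizations n) => ab [].
rewrite fsbig_finite//=; apply: le_trans (normc_sum _ _ _) _.
apply: (@le_trans _ _ (\sum_(ab <- fset_set (factorizations n `\ (mi1, n)))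
    C * (normc (f mi1))^-1 * mi_pow n alpha *
      mi_pow ab.1 (fun j => - (alpha j - r j)))).
  rewrite big_seq [leRHS]big_seq; apply: ler_sum => -[a b].
  rewrite in_fset_set// inE => Sab; have bn := factorizations_lt Sab.
  case: Sab => /= abn ne; rewrite normcM.
  have a1 : a <> mi1 by move=> a1; apply: ne; rewrite -abn a1 mi_mul1l.
  apply: le_trans (ler_pM (normc_ge0 _) (normc_ge0 _) (fC _ a1)
    (IH _ (leq_trans bn nm))) _.
  (* The induction gives b^alpha; writing a^r = a^alpha a^(r - alpha) recombines the powers into
     n^alpha times a^(r - alpha). *)
  rewrite -abn mi_powM le_eqVlt; apply/orP; left; apply/eqP.
  have -> : mi_pow a r = mi_pow a alpha * mi_pow a (fun j => - (alpha j - r j)).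
    rewrite !mi_powE -expRD -big_split; congr expR; apply: eq_bigr => j _ /=.
    by rewrite -mulrDl opprB addrC subrK.
  by ring.
rewrite -mulr_sumr mulrAC -[leRHS]mul1r ler_pM2r ?mi_pow_gt0//.
rewrite -ler_pdivlMl ?divr_gt0// invf_div mulr1.
(* What is left is that the sum of a^(r - alpha) over a != 1 is at most |f(1)| / C; adding 1
   restores the divisor a = 1. *)
rewrite -(lerD2l 1); apply: le_trans hzeta; rewrite -fsbig_finite//.
by apply: sum_factorizations_le => j; rewrite ltrBrDr.
Qed.

End DirichletInverse.

(** * Absolute convergence in the region *)

Section Region.
Variables (R : realType) (k : nat).
Implicit Types (f g : multi_index k -> R[i]) (n : multi_index k).

Lemma tail_sum_cst (c : R) (p : nat) : (p <= k)%N ->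
  tail_sum (fun _ : 'I_k => c) p.+1 = c *+ (k - p).
Proof.
move=> pk; rewrite /tail_sum -(big_geq_mkord p k xpredT (fun _ => c)) /=.
by rewrite sumr_const_nat.
Qed.

Lemma Re_tail_sum (s : 'I_k -> R[i]) m :
  complex.Re (tail_sum s m) = tail_sum (fun j => complex.Re (s j)) m.
Proof. by apply: (big_morph (@complex.Re R)) => // -[a b] [c d]. Qed.

(** The region amounts to finitely many strict inequalities T p > k - p on tail sums; the least
    relative slack T p / (k - p) - 1 serves as e. *)
Lemma region_gap (alpha : 'I_k -> R) (s : 'I_k -> R[i]) : region alpha s ->
  exists2 e : R, 0 < e & forall m,
    0 <= tail_sum (fun j => complex.Re (s j) - alpha j - (1 + e)) m.
Proof.
move=> reg; pose T p := tail_sum (fun j => complex.Re (s j) - alpha j) p.+1.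
have gap (p : 'I_k) : (k - p)%:R < T p.
  have := reg (k - p)%N; rewrite subn_gt0 ltn_ord leq_subr => /(_ isT).
  (* The inequality l = k - p concerns the tail starting at k - l + 1 = p + 1. *)
  rewrite subKn ?(ltnW (ltn_ord p))// addn1 Re_tail_sum -ltrBrDr.
  by rewrite /T /tail_sum sumrB.
(* The default 1 only caps the minimum and is positive, so e stays positive. *)
pose e := \big[Num.min/1]_(p < k) (T p / (k - p)%:R - 1).
have kp0 (p : 'I_k) : 0 < (k - p)%:R :> R by rewrite ltr0n subn_gt0.
exists e.
  by rewrite lt_bigmin// => p _; rewrite subr_gt0 ltr_pdivlMr// mul1r.
suff tail0 p : 0 <= tail_sum (fun j => complex.Re (s j) - alpha j - (1 + e)) p.+1.
  (* Coordinates are numbered from 1, so the tails from 0 and from 1 coincide. *)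
  by move=> [|m]; [exact: (tail0 0%N) | exact: tail0].
have [pk|kp] := ltnP p k; last first.
  rewrite /tail_sum big_pred0// => j; apply: negbTE; rewrite -leqNgt.
  exact: leq_trans (ltn_ord j) kp.
rewrite /tail_sum sumrB -!/(tail_sum _ p.+1) tail_sum_cst; last exact: ltnW.
rewrite -/(T p) subr_ge0 -mulr_natr -ler_pdivlMr; last exact: kp0 (Ordinal pk).
rewrite addrC -lerBrDr.
exact: (@bigmin_le_cond _ _ _ 1 (Ordinal pk) xpredT
  (fun q => T q / (k - q)%:R - 1)).
Qed.

(** After taking logarithms this is [abel_sum_ge0] for ln n_j, which is nonnegative, and
    nondecreasing because n is. *)
Lemma mi_pow_nondecreasing_le n (x : 'I_k -> R) (y : R) : mi_nondecreasing n ->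
    (forall m, 0 <= tail_sum (fun j => - x j - y) m) ->
  mi_pow n x <= \prod_(j < k) ((val (n j))%:R `^ y)^-1.
Proof.
move=> nnd x0.
have -> : \prod_(j < k) ((val (n j))%:R `^ y)^-1 = mi_pow n (fun _ => - y).
  by apply: eq_bigr => j _; rewrite powRN.
rewrite !mi_powE ler_expR -subr_ge0 -sumrB.
under eq_bigr do rewrite -mulrBl addrC.
apply: (abel_sum_ge0 (x := fun j => ln (val (n j))%:R)) => //.
- move=> i j ij; rewrite ler_ln ?posrE ?ltr0n ?ler_nat ?nnd//; exact: valP.
- by move=> j; rewrite ln_ge0// ler1n; exact: valP.
Qed.

Lemma normc_dirichlet_term f (s : 'I_k -> R[i]) n :
  normc (dirichlet_term f s n) =
  normc (f n) * mi_pow n (fun j => - complex.Re (s j)).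
Proof.
rewrite normcM normcV; congr (_ * _).
rewrite (big_morph (@normc R) (@normcM R) (normc1 R)) -prodfV.
by apply: eq_bigr => j _; rewrite normc_cpow powRN.
Qed.

(** Terms off the support vanish and the others are at most K h(n). Any finite set lies in a box,
    where h sums to a product of k partial zeta sums at 1 + e, bounded independently of the box. *)
Lemma abs_cvg_dirichlet f (K : R) (alpha : 'I_k -> R) (s : 'I_k -> R[i]) :
    (forall n, ~ mi_nondecreasing n -> f n = 0) ->
    (forall n, normc (f n) <= K * mi_pow n alpha) -> region alpha s ->
  exists M, forall A : {fset multi_index k},
    \sum_(n <- A) normc (dirichlet_term f s n) <= M.
Proof.
move=> fnd fK /region_gap[e e0 gap].
have K0 : 0 <= K by have := fK mi1; rewrite mi_pow1 mulr1; apply/le_trans/normc_ge0.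
pose h (n : multi_index k) := \prod_(j < k) (((val (n j))%:R : R) `^ (1 + e))^-1.
have h0 n : 0 <= h n by apply: prodr_ge0 => j _; rewrite invr_ge0 powR_ge0.
have term_le n : normc (dirichlet_term f s n) <= K * h n.
  rewrite normc_dirichlet_term.
  have [nnd|/fnd->] := pselect (mi_nondecreasing n); last first.
    by rewrite normc0 mul0r mulr_ge0.
  apply: le_trans (ler_wpM2r (ltW (mi_pow_gt0 _ _)) (fK n)) _.
  rewrite -mulrA ler_wpM2l//.
  have -> : mi_pow n alpha * mi_pow n (fun j => - complex.Re (s j)) =
      mi_pow n (fun j => alpha j - complex.Re (s j)).
    rewrite !mi_powE -expRD -big_split; congr expR; apply: eq_bigr => j _ /=.
    by rewrite mulrDl.
  apply: mi_pow_nondecreasing_le => // m; have := gap m.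
  by congr (0 <= _); apply: eq_bigr => j _; rewrite opprB.
exists (K * \prod_(j < k) (1 - 2 `^ (1 - (1 + e)))^-1) => A.
have [N /fsubsetP AN] := fset_sub_box A.
apply: le_trans (ler_sum _ (fun n _ => term_le n)) _.
rewrite -mulr_sumr ler_wpM2l//.
apply: (@le_trans _ _ (\sum_(n <- box k N) h n)); first exact: ler_sum_subseq.
rewrite /h (sum_box _ (fun _ i => ((i%:R : R) `^ (1 + e))^-1)).
apply: ler_prod => j _; apply/andP; split.
  by apply: sumr_ge0 => i _; rewrite invr_ge0 powR_ge0.
rewrite -(big_mkord xpredT (fun i => ((i.+1%:R : R) `^ (1 + e))^-1)).
by apply: series_riemannR_le; rewrite ltrDl.
Qed.

End Region.

(** * Multiplication of absolutely convergent series *)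

Section DirichletProduct.
Import summability.
Variables (R : realType) (k : nat).
Implicit Types (f g : multi_index k -> R[i]) (n : multi_index k).

#[local] Existing Instance totally_filter.

(** Boxes are cofinal among finite sets, so limits along [totally] can be read off along boxes. *)
Lemma box_totally : box k @ \oo --> totally.
Proof.
move=> P [A _ AP]; have [N AN] := fset_sub_box A; exists N => // M /= NM.
exact/AP/(fsubset_trans AN)/sub_box.
Qed.

Lemma box_square_totally : (fun N => box k (N * N)) @ \oo --> totally.
Proof.
move=> P /box_totally[M _ MP]; exists M => // N /= MN; apply: MP => /=.
by case: N MN => [|N] // /leq_trans; apply; rewrite mulnS leq_addr.
Qed.

(** Both factors of an element of a box lie in that box. The sum then runs over a list of pairs
    independent of n, which permits exchanging it with a sum over n. *)
Lemma sum_factorizations_box (T : nmodType) (F : multi_index k * multi_index k -> T)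
    N n : n \in box k N ->
  \sum_(ab \in factorizations n) F ab =
  \sum_(ab <- [seq (a, b) | a <- box k N, b <- box k N] | mi_mul ab.1 ab.2 == n)
    F ab.
Proof.
move=> nN; rewrite fsbig_finite; last exact: finite_factorizations.
rewrite -[RHS]big_filter; apply: perm_big; apply: uniq_perm.
- exact: fset_uniq.
- by rewrite filter_uniq// allpairs_uniq ?fset_uniq// => -[? ?] [].
- move=> [a b]; rewrite mem_filter in_fset_set; last exact: finite_factorizations.
  apply/idP/andP => [|[/eqP/= abn _]]; last by rewrite inE.
  rewrite inE /= => abn; split; first exact/eqP.
  apply/allpairsP; exists (a, b) => /=.
  by move: nN; rewrite -abn => /box_factors/andP[].
Qed.

Lemma dirichlet_term_mul f g (s : 'I_k -> R[i]) n :
  dirichlet_term (dirichlet_mul f g) s n =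
  \sum_(ab \in factorizations n)
    (dirichlet_term f s ab.1 * dirichlet_term g s ab.2).
Proof.
have fin := @finite_factorizations _ n.
rewrite /dirichlet_term /dirichlet_mul !fsbig_finite// mulr_suml.
rewrite big_seq [RHS]big_seq; apply: eq_bigr => -[a b].
rewrite in_fset_set// inE /= => <-; rewrite mulrACA -invfM -big_split/=.
by congr (_ / _); apply: eq_bigr => j _; rewrite ffunE cpow_mul.
Qed.

(* The pairs of box(N^2) x box(N^2) whose product leaves box(N^2) avoid
   box(N) x box(N), so their contribution is a Cauchy difference. *)
Lemma dirichlet_mul_box_le f g (s : 'I_k -> R[i]) N :
  normc ((\sum_(n <- box k (N * N)) dirichlet_term f s n) *
         (\sum_(n <- box k (N * N)) dirichlet_term g s n) -
         \sum_(n <- box k (N * N)) dirichlet_term (dirichlet_mul f g) s n) <=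
  (\sum_(n <- box k (N * N)) normc (dirichlet_term f s n)) *
  (\sum_(n <- box k (N * N)) normc (dirichlet_term g s n)) -
  (\sum_(n <- box k N) normc (dirichlet_term f s n)) *
  (\sum_(n <- box k N) normc (dirichlet_term g s n)).
Proof.
set u := dirichlet_term f s; set v := dirichlet_term g s.
pose Su M := \sum_(n <- box k M) normc (u n).
pose Sv M := \sum_(n <- box k M) normc (v n).
rewrite -!/(Su _) -!/(Sv _); set D := box k (N * N).
pose DD : seq (multi_index k * multi_index k) := [seq (a, b) | a <- D, b <- D].
pose F ab := u ab.1 * v ab.2.
have -> : (\sum_(n <- D) u n) * (\sum_(n <- D) v n) = \sum_(ab <- DD) F ab.
  by rewrite big_allpairs big_distrlr.
have -> : \sum_(n <- D) dirichlet_term (dirichlet_mul f g) s n =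
    \sum_(ab <- DD | mi_mul ab.1 ab.2 \in D) F ab.
  rewrite big_seq.
  under eq_bigr => n nD do rewrite dirichlet_term_mul (sum_factorizations_box _ nD).
  under eq_bigr do rewrite big_mkcond.
  rewrite exchange_big [RHS]big_mkcond /=; apply: eq_bigr => ab _.
  (* Each pair is counted once, at n = ab, when ab lies in D, and never otherwise. *)
  rewrite -big_seq; case: ifPn => abD.
    rewrite (bigD1_seq (mi_mul ab.1 ab.2)) ?fset_uniq//= eqxx.
    by rewrite big1 ?addr0// => n /eqP nab; case: eqP => // /esym/nab.
  rewrite big_seq big1// => n nD; case: eqP => // abn.
  by move: abD; rewrite abn nD.
pose G ab := normc (u ab.1) * normc (v ab.2).
have boxE M : Su M * Sv M =
    \sum_(ab <- [seq (a, b) | a <- box k M, b <- box k M]) G ab.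
  by rewrite big_allpairs big_distrlr.
have G0 ab : 0 <= G ab by rewrite mulr_ge0 ?normc_ge0.
rewrite (bigID (fun ab => mi_mul ab.1 ab.2 \in D))/= addrAC subrr add0r.
apply: le_trans (normc_sum _ _ _) _.
under eq_bigr do rewrite normcM -/(G _).
rewrite !boxE -/D -/DD lerBrDl [leRHS](bigID (fun ab => mi_mul ab.1 ab.2 \in D))/=.
(* After cancelling the pairs with product outside D, it remains to embed the pairs from box(N) into
   those with product in D. *)
rewrite lerD2r -[leRHS]big_filter; apply: ler_sum_subseq => //.
- by apply: allpairs_uniq; rewrite ?fset_uniq// => -[? ?] [].
- by rewrite filter_uniq// allpairs_uniq ?fset_uniq// => -[? ?] [].
move=> _ /allpairsP[[a b] /= [aN bN ->]]; rewrite mem_filter/= box_mul//=.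
have abD := box_mul aN bN.
have sND : (box k N `<=` D)%fset.
  by apply: sub_box; case: (N) => [|M] //; rewrite mulnS leq_addr.
by apply/allpairsP; exists (a, b); split => //=; apply: (fsubsetP sND).
Qed.

(** The product of partial sums over box(N^2) tends to U V. The partial sum of f * g differs from it
    by at most [d N], a difference of two sequences with the same limit a b. *)
Lemma dirichlet_mul_cvg f g (s : 'I_k -> R[i]) (Mf Mg : R) (U V : R[i]^o) :
    (forall A : {fset multi_index k},
      \sum_(n <- A) normc (dirichlet_term f s n) <= Mf) ->
    (forall A : {fset multi_index k},
      \sum_(n <- A) normc (dirichlet_term g s n) <= Mg) ->
    partial_sum (dirichlet_term f s) @ totally --> U ->
    partial_sum (dirichlet_term g s) @ totally --> V ->
  partial_sum (dirichlet_term (dirichlet_mul f g) s) (box k (N * N))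
    @[N --> \oo] --> (U * V : R[i]^o).
Proof.
move=> fM gM cvgU cvgV.
have [||a ha] := @cvg_ge0_partial_sum R _
  (fun n => normc (dirichlet_term f s n)) Mf.
- by move=> n; exact: normc_ge0.
- exact: fM.
have [||b hb] := @cvg_ge0_partial_sum R _
  (fun n => normc (dirichlet_term g s n)) Mg.
- by move=> n; exact: normc_ge0.
- exact: gM.
pose S (h : multi_index k -> R[i]^o) N : R[i]^o := partial_sum h (box k N).
pose u := dirichlet_term f s; pose v := dirichlet_term g s.
pose w := dirichlet_term (dirichlet_mul f g) s.
pose Su N : R := partial_sum (fun n => normc (u n)) (box k N).
pose Sv N : R := partial_sum (fun n => normc (v n)) (box k N).
have cvgUV : S u (N * N)%N * S v (N * N)%N @[N --> \oo] --> (U * V : R[i]^o).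
  by apply: cvgM; [exact: cvg_comp box_square_totally cvgU |
    exact: cvg_comp box_square_totally cvgV].
pose d N := Su (N * N)%N * Sv (N * N)%N - Su N * Sv N.
have cvg0 : d @ \oo --> (0 : R).
  rewrite -(subrr (a * b)); apply: cvgB; apply: cvgM.
  - exact: cvg_comp box_square_totally ha.
  - exact: cvg_comp box_square_totally hb.
  - exact: cvg_comp box_totally ha.
  - exact: cvg_comp box_totally hb.
rewrite -[U * V]subr0.
rewrite (_ : (fun N => _) = fun N => S u (N * N)%N * S v (N * N)%N -
    (S u (N * N)%N * S v (N * N)%N - S w (N * N)%N)); last first.
  by apply/funext => N; rewrite opprB addrC subrK.
apply: (cvgB cvgUV); apply/cvgr0Pnorm_lt => e e0.
have /(@cvgr0Pnorm_lt _ R[i]^o)/(_ e e0) :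
    ((d N)%:C : R[i]^o) @[N --> \oo] --> (0 : R[i]^o).
  exact: cvg_real_complex cvg0.
apply: filterS => N; apply: le_lt_trans.
have := dirichlet_mul_box_le f g s N.
rewrite /= -!partial_sumE => le; rewrite lecR; apply: le_trans le _.
rewrite -/(Su _) -/(Sv _) -/(d N); apply: le_trans (ler_norm _) _.
by rewrite -lecR; exact: (normc_ge_Re (d N)%:C).
Qed.

End DirichletProduct.

(** * Nonvanishing and the reciprocal formula *)

Theorem theorem3p7 (R : realType) (k : nat) (hk : (0 < k)%N)
    (f : multi_index k -> R[i]) (hf1 : f mi1 != 0)
    (hsupp : forall n : multi_index k, ~ mi_nondecreasing n -> f n = 0)
    (C : R) (hC : 0 < C) (r : 'I_k -> R)
    (hbound : forall n : multi_index k, n <> mi1 ->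
      `|f n| <= (C * \prod_(j < k) ((val (n j))%:R `^ r j))%:C)
    (alpha : 'I_k -> R) (halpha : forall j : 'I_k, 1 + r j < alpha j)
    (hzeta : (\prod_(j < k) zeta (alpha j - r j))%:C <= 1 + `|f mi1| / C%:C) :
  forall s : 'I_k -> R[i], region alpha s ->
    [/\ dirichlet_cvg f s /\ dirichlet_cvg (dirichlet_inv f) s,
        dirichlet_F f s != 0,
        dirichlet_F (dirichlet_inv f) s != 0
      & (dirichlet_F f s)^-1 = dirichlet_F (dirichlet_inv f) s].
Proof.
move=> s reg.
have fC n : n <> mi1 -> normc (f n) <= C * mi_pow n r.
  by move=> /hbound; rewrite lecR.
have zetaC : \prod_(j < k) zeta (alpha j - r j) <= 1 + normc (f mi1) / C.
  by rewrite -lecR rmorphD rmorph1 fmorph_div.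
(* The maximum covers n = 1, which [hbound] excludes, and r_j < alpha_j with n_j >= 1 allows alpha
   in place of r; f and its inverse then have bounds of the same form. *)
have fle n : normc (f n) <= Num.max C (normc (f mi1)) * mi_pow n alpha.
  have [->|/eqP n1] := eqVneq n mi1.
    by rewrite mi_pow1 mulr1 le_max lexx orbT.
  apply: le_trans (fC _ n1) _; apply: ler_pM.
  - exact: ltW.
  - exact/ltW/mi_pow_gt0.
  - by rewrite le_max lexx.
  - apply: ler_prod => j _; rewrite powR_ge0/= ler_powR//.
      by rewrite ler1n; exact: valP.
    by apply: ltW; apply: le_lt_trans (halpha j); rewrite lerDr.
have gle n : normc (dirichlet_inv f n) <= (normc (f mi1))^-1 * mi_pow n alpha.
  exact: dirichlet_inv_le fC halpha zetaC.
have [Mf fM] := abs_cvg_dirichlet hsupp fle reg.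
have [Mg gM] :=
  abs_cvg_dirichlet (fun n => dirichlet_inv_supp hf1 hsupp) gle reg.
have [U cvgU] := abs_cvg_partial_sum fM.
have [V cvgV] := abs_cvg_partial_sum gM.
have UV1 : U * V = 1 :> R[i].
  have cvgUV := dirichlet_mul_cvg fM gM cvgU cvgV.
  rewrite dirichlet_invP// in cvgUV.
  apply: (cvg_unique _ cvgUV); first exact: norm_hausdorff.
  (* For N >= 1 the box contains n = 1, the only index where [dirichlet_id] is nonzero, so every
     such partial sum equals 1. *)
  apply: cvg_near_cst; exists 1%N => // N /= N0.
  rewrite partial_sumE (bigD1_seq mi1) ?fset_uniq ?box1 ?muln_gt0 ?N0//=.
  rewrite big1 ?addr0 /dirichlet_term /dirichlet_id ?eqxx.
    rewrite big1 ?divr1// => j _; rewrite ffunE /cpow/= powR1 ln1 mulr0.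
    by rewrite cos0 sin0 mul1r.
  by move=> n /negbTE->; rewrite mul0r.
have [U0 V0] : U != 0 /\ V != 0.
  by apply/andP; rewrite -negb_or -mulf_eq0 UV1 oner_eq0.
rewrite /dirichlet_F (cvg_sum cvgU) (cvg_sum cvgV).
split; [split; [exact: cvgP cvgU | exact: cvgP cvgV] | exact: U0 | exact: V0 |].
by apply: (mulfI U0); rewrite mulfV.
Qed.
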